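(* Let $d,n\ge 3$ and let $I_2\subseteq \mathcal C[x_{ij}\mid (i,j)\in[d]\times[n]]$ be the ideal generated by all $3\times 3$-minors of the $d\times n$-matrix of variables $(x_{ij})$. Then the $3\times 3$-minors form a set of positive-tropical generators for the tropical determinantal variety of matrices of rank at most $2$, i.e. $$\operatorname{trop}\big(V(I_2)\cap \mathcal C_+^{d\times n}\big)=\bigcap_{f \text{ a } 3\times 3\text{-minor}}\operatorname{trop}\big(V(f)\cap\mathcal C_+^{d\times n}\big).$$
   Context: $\mathcal C=\bigcup_{m\ge1}\mathbb C((t^{1/m}))$ is the field of Puiseux series over $\mathbb C$. For $0\ne x\in\mathcal C$, $\operatorname{lc}(x)$ is the coefficient of the term of lowest exponent and $\operatorname{val}(x)$ is that lowest exponent; $\operatorname{val}$ is applied coordinatewise to vectors and matrices. $\mathcal C_+=\{x\in\mathcal C\mid \operatorname{lc}(x)\in\mathbb R_{>0}\}$. For a subset $S\subseteq\mathcal C^N$, $\operatorname{trop}(S)$ is the closure of $\{\operatorname{val}(z)\mid z\in S\cap(\mathcal C^* )^N\}$ in $(\mathbb R\cup\{\infty\})^N$. $V(\cdot)$ is the zero set in $\mathcal C^{d\times n}$. A finite set $\mathcal F$ of polynomials is a set of positive-tropical generators for an ideal $I$ (or for $\operatorname{trop}(V(I))$) if $\operatorname{trop}(V(I)\cap\mathcal C_+^N)=\bigcap_{f\in\mathcal F}\operatorname{trop}(V(f)\cap\mathcal C_+^N)$. *)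

(* Defs.v *)
From HB Require Import structures.
From mathcomp Require Import all_boot all_order all_algebra.
From mathcomp Require Import all_classical all_reals all_analysis.
From mathcomp Require Import zify.
From mathcomp Require Import complex.
(* The notations of [mpoly] clash with those of the analysis library. *)
From mathcomp Require Import -(notations) mpoly.

Set Implicit Arguments.
Unset Strict Implicit.
Unset Printing Implicit Defensive.

Import Order.TTheory GRing.Theory Num.Theory.

Local Open Scope classical_set_scope.
Local Open Scope ring_scope.

Section PuiseuxSupport.
Variable K : fieldType.
Implicit Types (f g h : rat -> K) (m k : nat) (a b : int).

Definition gridpt m a k : rat := (a + k%:Z)%:~R / m%:R.

Definition on_grid m a f := forall q, f q != 0 -> exists k, q = gridpt m a k.

(* The exponents occurring in [f] are bounded below and have a common
   denominator. *)
Definition puiseux_support f :=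
  exists2 m, (0 < m)%N & exists a, on_grid m a f.

(* The sum has finite support as soon as [f] and [g] are Puiseux series. *)
Definition conv f g (q : rat) : K := \sum_(p \in [set: rat]) f p * g (q - p).

Lemma gridptD m a b i j : gridpt m a i + gridpt m b j = gridpt m (a + b) (i + j).
Proof. by rewrite /gridpt -mulrDl -intrD PoszD addrACA. Qed.

Lemma gridptB m a b i k : (i <= k)%N ->
  gridpt m (a + b) k - gridpt m a i = gridpt m b (k - i).
Proof. by move=> ik; apply/eqP; rewrite subr_eq [_ + gridpt m a i]addrC gridptD subnKC. Qed.

Lemma gridpt_inj m a : (0 < m)%N -> injective (gridpt m a).
Proof.
move=> m0 i j; have mn0 : m%:R != 0 :> rat by rewrite pnatr_eq0 -lt0n.
by move=> /(divIf mn0)/intr_inj/addrI[].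
Qed.

Lemma on_grid_refine m m' a f : (0 < m')%N ->
  on_grid m a f -> on_grid (m * m') (a * m'%:Z) f.
Proof.
move=> m'0 H q /H[k ->]; exists (k * m')%N.
rewrite /gridpt PoszM -mulrDl intrM natrM -mulf_div.
by rewrite pmulrn divff ?mulr1// intr_eq0 eqz_nat -lt0n.
Qed.

Lemma on_grid_lower m a b f : b <= a -> on_grid m a f -> on_grid m b f.
Proof.
move=> ba H q /H[k ->]; exists (`|a - b| + k)%N.
rewrite /gridpt; congr (_%:~R / _); lia.
Qed.

Lemma puiseux_support_common f g : puiseux_support f -> puiseux_support g ->
  exists2 m, (0 < m)%N & exists a, on_grid m a f /\ on_grid m a g.
Proof.
move=> [m m0 [a Hf]] [m' m'0 [b Hg]]; exists (m * m')%N; first by rewrite muln_gt0 m0.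
exists (Num.min (a * m'%:Z) (b * m%:Z)); split.
  by apply: (on_grid_lower _ (on_grid_refine m'0 Hf)); rewrite ge_min lexx.
rewrite mulnC; apply: (on_grid_lower _ (on_grid_refine m0 Hg)).
by rewrite ge_min lexx orbT.
Qed.

Lemma puiseux_support_common3 f g h :
  puiseux_support f -> puiseux_support g -> puiseux_support h ->
  exists2 m, (0 < m)%N & exists a,
    [/\ on_grid m a f, on_grid m a g & on_grid m a h].
Proof.
move=> sf sg [m' m'0 [b Hh]].
have [m m0 [a [Hf Hg]]] := puiseux_support_common sf sg.
exists (m * m')%N; first by rewrite muln_gt0 m0.
exists (Num.min (a * m'%:Z) (b * m%:Z)); split.
- by apply: (on_grid_lower _ (on_grid_refine m'0 Hf)); rewrite ge_min lexx.
- by apply: (on_grid_lower _ (on_grid_refine m'0 Hg)); rewrite ge_min lexx.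
- rewrite mulnC; apply: (on_grid_lower _ (on_grid_refine m0 Hh)).
  by rewrite ge_min lexx orbT.
Qed.

Lemma on_grid_eq m a f g : on_grid m a f -> on_grid m a g ->
  (forall k, f (gridpt m a k) = g (gridpt m a k)) -> f = g.
Proof.
move=> Hf Hg E; apply/funext => q; have [f0|/Hf[k ->]//] := eqVneq (f q) 0.
by have [g0|/Hg[k ->]//] := eqVneq (g q) 0; rewrite f0 g0.
Qed.

Lemma on_grid_conv m a b f g : on_grid m a f -> on_grid m b g ->
  on_grid m (a + b) (conv f g).
Proof.
move=> Hf Hg q; have [[p]|N] := pselect (exists p, f p * g (q - p) != 0).
  rewrite mulf_eq0 negb_or => /andP[/Hf[i pi] /Hg[j qj]] _.
  by exists (i + j)%N; rewrite -gridptD -pi -qj subrKC.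
rewrite /conv fsbig1 ?eqxx// => p _; apply/eqP/negPn/negP => H.
by apply: N; exists p.
Qed.

Lemma conv_gridpt m a b f g k : (0 < m)%N -> on_grid m a f -> on_grid m b g ->
  conv f g (gridpt m (a + b) k) =
  \sum_(i < k.+1) f (gridpt m a i) * g (gridpt m b (k - i)).
Proof.
move=> m0 Hf Hg; rewrite /conv -(fsbig_widen (gridpt m a @` `I_k.+1))//; last first.
  move=> p [_ /= Np]; apply/eqP/negPn/negP.
  rewrite mulf_eq0 negb_or => /andP[/Hf[i pi] /Hg[j qj]]; apply: Np.
  exists i => //=; move/eqP: qj; rewrite subr_eq [gridpt m b j + p]addrC pi gridptD.
  by move=> /eqP/(gridpt_inj m0) ->; rewrite ltnS leq_addr.
rewrite fsbig_image; last by move=> i j _ _; apply: gridpt_inj.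
rewrite (fsbig_ord _ _ (fun i => f (gridpt m a i) * g (gridpt m b (k - i)))).
by apply: eq_fsbigr => i; rewrite inE/= ltnS => ik; rewrite gridptB.
Qed.

Lemma puiseux_support_conv f g :
  puiseux_support f -> puiseux_support g -> puiseux_support (conv f g).
Proof.
move=> sf sg; have [m m0 [a [Hf Hg]]] := puiseux_support_common sf sg.
by exists m => //; exists (a + a); apply: on_grid_conv.
Qed.

Lemma convC f g : puiseux_support f -> puiseux_support g -> conv f g = conv g f.
Proof.
move=> sf sg; have [m m0 [a [Hf Hg]]] := puiseux_support_common sf sg.
apply: (on_grid_eq (on_grid_conv Hf Hg) (on_grid_conv Hg Hf)) => k.
rewrite !conv_gridpt// (reindex_inj rev_ord_inj)/=; apply: eq_bigr => i _.
by rewrite subSS mulrC subKn// -ltnS.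
Qed.

Lemma sum_conv_coef (u v : nat -> K) k n : (k < n)%N ->
  \sum_(i < k.+1) u i * v (k - i)%N =
  ((\poly_(i < n) u i) * (\poly_(i < n) v i))`_k.
Proof.
move=> kn; rewrite coefM; apply: eq_bigr => i _.
rewrite !coef_poly (leq_ltn_trans (leq_subr _ _) kn).
by rewrite (leq_ltn_trans _ kn)// -ltnS.
Qed.

Lemma convA f g h : puiseux_support f -> puiseux_support g ->
  puiseux_support h -> conv f (conv g h) = conv (conv f g) h.
Proof.
move=> sf sg sh; have [m m0 [a [Hf Hg Hh]]] := puiseux_support_common3 sf sg sh.
have Hgh := on_grid_conv Hg Hh; have Hfg := on_grid_conv Hf Hg.
have E : a + (a + a) = a + a + a by rewrite addrA.
apply: (@on_grid_eq m (a + (a + a))).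
- exact: on_grid_conv.
- by rewrite E; exact: on_grid_conv.
move=> k; rewrite conv_gridpt// E conv_gridpt//.
pose P e := \poly_(i < k.+1) e (gridpt m a i) : {poly K}.
transitivity ((P f * (P g * P h))`_k).
  rewrite coefM; apply: eq_bigr => i _; congr (_ * _).
    by rewrite coef_poly ltn_ord.
  by rewrite conv_gridpt// -sum_conv_coef ?ltnS ?leq_subr.
rewrite mulrA coefM; apply: eq_bigr => i _; congr (_ * _).
  by rewrite conv_gridpt// -sum_conv_coef ?ltn_ord.
by rewrite coef_poly ltnS leq_subr.
Qed.

Lemma on_gridD m a f g :
  on_grid m a f -> on_grid m a g -> on_grid m a (fun q => f q + g q).
Proof.
move=> Hf Hg q; have [f0|/Hf//] := eqVneq (f q) 0.
by rewrite f0 add0r => /Hg.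
Qed.

Lemma convDl f g h : puiseux_support f -> puiseux_support g ->
  puiseux_support h ->
  conv (fun q => f q + g q) h = (fun q => conv f h q + conv g h q).
Proof.
move=> sf sg sh; have [m m0 [a [Hf Hg Hh]]] := puiseux_support_common3 sf sg sh.
have Hfg := on_gridD Hf Hg.
apply: (@on_grid_eq m (a + a)); first exact: on_grid_conv.
  by apply: on_gridD; exact: on_grid_conv.
move=> k; rewrite !conv_gridpt// -big_split/=.
by apply: eq_bigr => i _; rewrite mulrDl.
Qed.

Definition monom0 (q : rat) : K := (q == 0)%:R.

Lemma gridpt0 m : gridpt m 0 0 = 0. Proof. by rewrite /gridpt addr0 mul0r. Qed.

Lemma on_grid_monom0 m : on_grid m 0 monom0.
Proof.
move=> q; rewrite /monom0; case: (eqVneq q 0) => [-> _|_]; last by rewrite eqxx.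
by exists 0%N; rewrite gridpt0.
Qed.

Lemma monom0_gridpt m k : (0 < m)%N -> monom0 (gridpt m 0 k) = (k == 0%N)%:R.
Proof. by move=> m0; rewrite /monom0 -(gridpt0 m) (inj_eq (gridpt_inj m0)). Qed.

Lemma conv1f f : puiseux_support f -> conv monom0 f = f.
Proof.
move=> [m m0 [a Hf]]; apply: (@on_grid_eq m (0 + a)).
- by apply: on_grid_conv => //; exact: on_grid_monom0.
- by rewrite add0r.
move=> k; rewrite conv_gridpt//; last exact: on_grid_monom0.
rewrite big_ord_recl big1 ?addr0.
  by rewrite monom0_gridpt// mul1r subn0 add0r.
by move=> i _; rewrite monom0_gridpt// mul0r.
Qed.

Section ConvInverse.
Variable u : nat -> K.
Hypothesis u0 : u 0%N != 0.

Fixpoint inv_prefix n : seq K :=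
  if n is n'.+1 then
    let s := inv_prefix n' in
    rcons s (((n' == 0%N)%:R - \sum_(i < n') u (n' - i)%N * s`_i) / u 0%N)
  else [::].

Definition inv_coef n := (inv_prefix n.+1)`_n.

Lemma size_inv_prefix n : size (inv_prefix n) = n.
Proof. by elim: n => //= n IH; rewrite size_rcons IH. Qed.

Lemma nth_inv_prefix n i : (i < n)%N -> (inv_prefix n)`_i = inv_coef i.
Proof.
elim: n => // n IH; rewrite ltnS leq_eqVlt => /predU1P[->//|lin].
by rewrite [LHS]/= nth_rcons size_inv_prefix lin IH.
Qed.

Lemma inv_coefP k : \sum_(i < k.+1) inv_coef i * u (k - i)%N = (k == 0%N)%:R.
Proof.
rewrite big_ord_recr/= subnn {2}/inv_coef/= nth_rcons size_inv_prefix ltnn eqxx.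
rewrite divfK//; under [X in _ - X]eq_bigr => i _.
  by rewrite nth_inv_prefix// mulrC; over.
by rewrite subrKC.
Qed.

End ConvInverse.

Lemma support_min f : puiseux_support f -> f <> (fun=> 0) ->
  exists2 m, (0 < m)%N & exists2 a, on_grid m a f & f (gridpt m a 0) != 0.
Proof.
move=> [m m0 [a Hf]] f0; exists m => //.
have exk : exists k, f (gridpt m a k) != 0.
  apply: contrapT => N; apply: f0; apply: (on_grid_eq Hf) => [q|k].
    by rewrite eqxx.
  by apply/eqP/negPn/negP => H; apply: N; exists k.
case: (ex_minnP exk) => k fk mink; exists (a + k%:Z).
  move=> q fq; have [i qi] := Hf _ fq; rewrite qi in fq.
  exists (i - k)%N; rewrite qi /gridpt; congr (_%:~R / _).
  by have := mink _ fq; lia.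
by rewrite /gridpt addr0.
Qed.

Lemma conv_inv f : puiseux_support f -> f <> (fun=> 0) ->
  exists2 g, puiseux_support g & conv g f = monom0.
Proof.
move=> sf /(support_min sf)[m m0 [a Hf fa]].
pose v := inv_coef (fun k => f (gridpt m a k)).
pose g (q : rat) := let z := q * m%:R + a%:~R in
  if z \is a Num.nat then v (Num.truncn z) else 0.
have m0' : m%:R != 0 :> rat by rewrite pnatr_eq0 -lt0n.
have Hg : on_grid m (- a) g.
  move=> q; rewrite /g; case: ifPn => [/natrP[k E] _|_]; last by rewrite eqxx.
  exists k; rewrite /gridpt intrD intrN -(pmulrn 1 k) -E [- _ + _]addrC addrK.
  by rewrite mulfK.
have gE k : g (gridpt m (- a) k) = v k.
  rewrite /g /gridpt divfK// intrD intrN [- _ + _]addrC subrK -(pmulrn 1 k).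
  by rewrite natr_nat natrK.
exists g; first by exists m => //; exists (- a).
apply: (@on_grid_eq m (- a + a)).
- exact: on_grid_conv.
- by rewrite addNr; exact: on_grid_monom0.
move=> k; rewrite conv_gridpt// addNr monom0_gridpt// -(@inv_coefP (fun k => f (gridpt m a k)) fa).
by apply: eq_bigr => i _; rewrite gE.
Qed.

End PuiseuxSupport.

(* [Puiseux f] is the series \sum_q (f q) t^q *)
Record puiseux (K : fieldType) := Puiseux {
  pcoef :> rat -> K;
  _ : `[< puiseux_support pcoef >] }.

HB.instance Definition _ (K : fieldType) := [isSub for @pcoef K].
HB.instance Definition _ (K : fieldType) := [Choice of puiseux K by <:].

Section PuiseuxField.
Variable K : fieldType.
Implicit Types x y z : puiseux K.

Lemma pcoefP x : puiseux_support x.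
Proof. by case: x => f sf; apply/asboolP. Qed.

Lemma puiseux_eq x y : pcoef x = pcoef y -> x = y.
Proof. exact: val_inj. Qed.

Definition mkPuiseux (f : rat -> K) (sf : puiseux_support f) : puiseux K :=
  Puiseux (introT (asboolP _) sf).

Lemma puiseux_support0 : puiseux_support (fun=> 0 : K).
Proof. by exists 1%N => //; exists 0 => q; rewrite eqxx. Qed.

Lemma puiseux_supportN x : puiseux_support (fun q => - x q).
Proof.
have [m m0 [a H]] := pcoefP x; exists m => //; exists a => q.
by rewrite oppr_eq0 => /H.
Qed.

Lemma puiseux_supportD x y : puiseux_support (fun q => x q + y q).
Proof.
have [m m0 [a [Hx Hy]]] := puiseux_support_common (pcoefP x) (pcoefP y).
by exists m => //; exists a; exact: on_gridD.
Qed.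

Lemma puiseux_support1 : puiseux_support (@monom0 K).
Proof. by exists 1%N => //; exists 0; exact: on_grid_monom0. Qed.

Definition puiseux0 := mkPuiseux puiseux_support0.
Definition puiseux1 := mkPuiseux puiseux_support1.
Definition puiseux_opp x := mkPuiseux (puiseux_supportN x).
Definition puiseux_add x y := mkPuiseux (puiseux_supportD x y).
Definition puiseux_mul x y :=
  mkPuiseux (puiseux_support_conv (pcoefP x) (pcoefP y)).

Lemma puiseux_addA : associative puiseux_add.
Proof. by move=> x y z; apply/puiseux_eq/funext => q /=; rewrite addrA. Qed.

Lemma puiseux_addC : commutative puiseux_add.
Proof. by move=> x y; apply/puiseux_eq/funext => q /=; rewrite addrC. Qed.

Lemma puiseux_add0 : left_id puiseux0 puiseux_add.
Proof. by move=> x; apply/puiseux_eq/funext => q /=; rewrite add0r. Qed.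

Lemma puiseux_addN : left_inverse puiseux0 puiseux_opp puiseux_add.
Proof. by move=> x; apply/puiseux_eq/funext => q /=; rewrite addNr. Qed.

HB.instance Definition _ := GRing.isZmodule.Build (puiseux K)
  puiseux_addA puiseux_addC puiseux_add0 puiseux_addN.

Lemma puiseux_mulA : associative puiseux_mul.
Proof. by move=> x y z; apply/puiseux_eq/convA; exact: pcoefP. Qed.

Lemma puiseux_mulC : commutative puiseux_mul.
Proof. by move=> x y; apply/puiseux_eq/convC; exact: pcoefP. Qed.

Lemma puiseux_mul1 : left_id puiseux1 puiseux_mul.
Proof. by move=> x; apply/puiseux_eq/conv1f; exact: pcoefP. Qed.

Lemma puiseux_mulDl : left_distributive puiseux_mul +%R.
Proof. by move=> x y z; apply/puiseux_eq/convDl; exact: pcoefP. Qed.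

Lemma puiseux1_neq0 : puiseux1 != 0.
Proof.
apply/eqP => /(congr1 (fun x : puiseux K => x 0)) /eqP.
by rewrite /= /monom0 eqxx oner_eq0.
Qed.

HB.instance Definition _ := GRing.Zmodule_isComNzRing.Build (puiseux K)
  puiseux_mulA puiseux_mulC puiseux_mul1 puiseux_mulDl puiseux1_neq0.

(* The inverse of [x], or 0 if there is none. *)
Definition puiseux_inv x : puiseux K := xget 0 [set y | y * x = 1].

Lemma puiseux_neq0 x : x != 0 -> pcoef x <> (fun=> 0).
Proof. by move=> /eqP x0 E; apply: x0; exact: puiseux_eq. Qed.

Lemma puiseux_mulVf x : x != 0 -> puiseux_inv x * x = 1.
Proof.
move=> /puiseux_neq0 /(conv_inv (pcoefP x))[g sg gx].
by apply: (@xgetPex _ 0 [set y | y * x = 1]); exists (mkPuiseux sg); exact: puiseux_eq.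
Qed.

Lemma puiseux_inv0 : puiseux_inv 0 = 0.
Proof.
rewrite /puiseux_inv xgetPN// => y /=; rewrite mulr0.
by apply/eqP; rewrite eq_sym oner_eq0.
Qed.

HB.instance Definition _ := GRing.ComNzRing_isField.Build (puiseux K)
  puiseux_mulVf puiseux_inv0.

Definition lowest_exponent x : rat :=
  xget 0 [set q | x q != 0 /\ forall p, x p != 0 -> q <= p].

Lemma lowest_exponentP x : x != 0 ->
  x (lowest_exponent x) != 0 /\ forall p, x p != 0 -> lowest_exponent x <= p.
Proof.
move=> /puiseux_neq0 /(support_min (pcoefP x))[m m0 [a Hx xa]].
apply: (@xgetPex _ 0 [set q | x q != 0 /\ forall p, x p != 0 -> q <= p]).
exists (gridpt m a 0); split => // p /Hx[k ->].
by rewrite /gridpt ler_pM2r ?invr_gt0 ?ltr0n// ler_int lerD2l.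
Qed.

(* Only meaningful for [x != 0]. *)
Definition lc x : K := x (lowest_exponent x).

End PuiseuxField.

Section Tropical.
Variable R : realType.

Local Notation PC := (puiseux R[i]).

Definition pval (x : PC) : \bar R :=
  if x == 0 then +oo%E else (ratr (lowest_exponent x))%:E.

Definition positive_puiseux : set PC :=
  [set x | x != 0 /\ exists2 r : R, 0 < r & lc x = (r%:C)%C].

Variables d n : nat.

Definition torus : set 'M[PC]_(d, n) := [set A | forall i j, A i j != 0].

Definition positive_orthant : set 'M[PC]_(d, n) :=
  [set A | forall i j, positive_puiseux (A i j)].

(* The closure in \bar R contains points with coordinates -oo; discarding them
   gives the closure in the subspace of matrices over R \cup {+oo}. *)
Definition trop (S : set 'M[PC]_(d, n)) : set 'M[\bar R]_(d, n) :=
  closure [set map_mx pval A | A in S `&` torus]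
    `&` [set w | forall i j, w i j != -oo%E].

(* Polynomials in the entries x_ij of a d x n matrix, where x_ij is the
   variable of index [mxvec_index i j]. *)
Local Notation mxpoly := (mpoly (d * n) PC).

Definition generic_mx : 'M[mxpoly]_(d, n) :=
  \matrix_(i, j) mpolyX PC (mnm1 (mxvec_index i j)).

Definition eval_mxpoly (A : 'M[PC]_(d, n)) (p : mxpoly) : PC :=
  meval (fun k => mxvec A 0 k) p.

Lemma eval_generic_mx A i j : eval_mxpoly A (generic_mx i j) = A i j.
Proof. by rewrite mxE /eval_mxpoly mevalXU mxvecE. Qed.

Definition zero_set (F : set mxpoly) : set 'M[PC]_(d, n) :=
  [set A | forall p, F p -> eval_mxpoly A p = 0].

Definition ideal_generated (F : set mxpoly) : set mxpoly :=
  [set p | exists2 s : seq (mxpoly * mxpoly),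
     (forall c, c \in s -> F c.2) & p = \sum_(c <- s) c.1 * c.2].

(* The k x k minors of the generic matrix, with rows and columns listed in
   increasing order. *)
Definition minors k : set mxpoly :=
  [set p | exists f : 'I_k -> 'I_d, exists g : 'I_k -> 'I_n,
     [/\ {homo f : i j / (i < j)%N}, {homo g : i j / (i < j)%N}
       & p = \det (mxsub f g generic_mx)]].

Definition determinantal_ideal r : set mxpoly := ideal_generated (minors r.+1).

Definition positive_tropical_generators (F I : set mxpoly) :=
  finite_set F /\
  trop (zero_set I `&` positive_orthant) =
  \bigcap_(f in F) trop (zero_set [set f] `&` positive_orthant).

End Tropical.

(* Main.v *)
Require Import Defs.
From mathcomp Require Import all_boot all_order all_algebra.
From mathcomp Require Import all_classical all_reals all_analysis.
From mathcomp Require Import ring lra zify complex.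
From mathcomp Require Import -(notations) mpoly.

(** A matrix lies in the positive tropicalization of the rank-two variety
    exactly when it is a tropical (min-plus) sum of two outer products,
    w_ij = min(p_i + q_j, p'_i + q'_j), with entries in R united with +oo.

    Sufficiency is a lifting argument ([two_term_in_trop]): after approximating
    p, q, p', q' by rational vectors, the matrix with entries
    t^(p_i) t^(q_j) + t^(p'_i) t^(q'_j) is positive, has rank at most two, and
    its valuation is the given tropical sum because positive leading
    coefficients do not cancel.

    For necessity, membership in the hypersurface of every 3 x 3 minor has to
    yield such a decomposition.  If a positive 3 x 3 matrix is singular, the
    even and the odd terms of its determinant have equal sums, and since nothing
    cancels inside either sum, the tropical minimum is attained by an even and
    by an odd permutation.  These two permutations agree in one position, and
    the tie forces one row of valuations to be a tropical combination of the two
    other rows ([positive_singular]).  That conclusion has to survive the passage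
    to the closure, where entries may become infinite; for this it is expressed by
    finitely many weak inequalities between sums of two entries
    ([sector_dependent]), which persist in limits free of -oo and imply tropical
    dependence there ([sector_dependent_span]).

    The passage from 3 x 3 blocks to the whole matrix uses a single principle
    twice: a family of vectors of which any three are dependent is spanned by two
    of its members ([span_of_two]).  Applied to the rows of a d x 3 block, it
    shows that the block is a sum of two outer products.  As any three vectors
    with two coordinates are dependent ([span_dependent_pairs]), the three columns
    of the block are dependent as well, and the principle applied to the columns
    of the full matrix gives the decomposition ([two_term_decomposition]). *)

Set Implicit Arguments.
Unset Strict Implicit.
Unset Printing Implicit Defensive.

Import Order.TTheory GRing.Theory Num.Theory.
Import numFieldNormedType.Exports.
Local Open Scope classical_set_scope.
Local Open Scope ring_scope.

(** * Positive Puiseux series *)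

Section PositivePuiseux.
Variable R : realType.
Local Notation PC := (puiseux R[i]).
Implicit Types (x y : PC) (p q : rat).

(** Positivity together with the valuation: stating both by coefficients
    avoids the choice operator behind [lowest_exponent]. *)
Definition pos_of_val x q :=
  (forall p, p < q -> x p = 0) /\ exists2 r : R, 0 < r & x q = (r%:C)%C.

Lemma pos_of_val_neq0 x q : pos_of_val x q -> x q != 0.
Proof.
by move=> [_ [r r0 ->]]; rewrite (inj_eq (@complexI _)) gt_eqF.
Qed.

Lemma pos_of_val_inj x p q : pos_of_val x p -> pos_of_val x q -> p = q.
Proof.
move=> xp xq; have /eqP xp0 := pos_of_val_neq0 xp; have /eqP xq0 := pos_of_val_neq0 xq.
by case: (ltgtP p q) => // [/xq.1//|/xp.1].
Qed.

Lemma pos_of_val_nz x q : pos_of_val x q -> x != 0.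
Proof. by move=> /pos_of_val_neq0; apply: contraNneq => ->. Qed.

Lemma pos_of_val_lowest x q : pos_of_val x q -> lowest_exponent x = q.
Proof.
move=> xq; have /lowest_exponentP [xl lmin] := pos_of_val_nz xq.
apply/eqP; rewrite eq_le lmin ?pos_of_val_neq0//= leNgt.
by apply/negP => /xq.1 /eqP; apply/negP.
Qed.

Lemma positive_puiseuxP x :
  positive_puiseux x <-> exists q, pos_of_val x q.
Proof.
split=> [[x0 [r r0 xr]]|[q xq]].
  exists (lowest_exponent x); split; last by exists r.
  move=> p; rewrite ltNge => /negP pl; apply/eqP/negPn/negP => xp; apply: pl.
  exact: (lowest_exponentP x0).2.
split; first exact: pos_of_val_nz xq.
by rewrite /lc (pos_of_val_lowest xq); case: xq.
Qed.

Lemma pval_pos x q : pos_of_val x q -> pval x = (ratr q)%:E.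
Proof.
by move=> xq; rewrite /pval (negPf (pos_of_val_nz xq)) (pos_of_val_lowest xq).
Qed.

(** Leading coefficients of positive series add up to a positive number, so
    they never cancel. *)
Lemma pos_of_valD x y p q : pos_of_val x p -> pos_of_val y q ->
  pos_of_val (x + y) (Num.min p q).
Proof.
move=> [x0 [r r0 xr]] [y0 [s s0 ys]]; split=> [u|].
  rewrite lt_min => /andP[up uq]; change (x u + y u = 0).
  by rewrite x0// y0// addr0.
change (exists2 t : R, 0 < t & x (Num.min p q) + y (Num.min p q) = (t%:C)%C).
case: (ltgtP p q) => [pq|qp|pq].
- by exists r => //; rewrite xr y0// addr0.
- by exists s => //; rewrite ys x0// add0r.
- by subst q; exists (r + s); rewrite ?addr_gt0// xr ys rmorphD.
Qed.

Lemma pos_of_valM x y p q : pos_of_val x p -> pos_of_val y q ->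
  pos_of_val (x * y) (p + q).
Proof.
move=> [x0 [r r0 xr]] [y0 [s s0 ys]]; split=> [u upq|].
  change (Defs.conv x y u = 0); rewrite /Defs.conv fsbig1// => v _.
  have [vp|pv] := ltP v p; first by rewrite x0// mul0r.
  by rewrite [y _]y0 ?mulr0//; lra.
exists (r * s); first exact: mulr_gt0.
change (Defs.conv x y (p + q) = ((r * s)%:C)%C).
(* Only the product of the two leading terms contributes at exponent p + q. *)
rewrite /Defs.conv -(fsbig_widen [set p])//=; last first.
  move=> v [_ /= /eqP]; rewrite neq_lt => /orP[vp|pv]; first by rewrite x0// mul0r.
  by rewrite [y _]y0 ?mulr0//; lra.
by rewrite fsbig_set1 addrAC subrr add0r xr ys rmorphM.
Qed.

Lemma monomial_support q : puiseux_support (fun p => (p == q)%:R : R[i]).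
Proof.
exists `|denq q|%N; first by rewrite absz_gt0 denq_neq0.
exists (numq q) => p; case: (p =P q) => [-> _|_]; last by rewrite eqxx.
by exists 0%N; rewrite /gridpt addr0 -{1}(divq_num_den q) pmulrn absz_denq.
Qed.

Definition monomial q : PC := mkPuiseux (monomial_support q).

Lemma pos_of_val_monomial q : pos_of_val (monomial q) q.
Proof.
split=> [p pq|]; first by rewrite /= lt_eqF.
by exists 1 => //=; rewrite eqxx.
Qed.

End PositivePuiseux.

(** * Linear dependence over the min-plus semiring *)

Section TropicalDependence.
Local Open Scope ereal_scope.
Variable R : realType.
Implicit Types (a b c l m : \bar R).

Lemma adde_minr a b c : a + mine b c = mine (a + b) (a + c).
Proof.
by have [bc|/ltW cb] := leP b c;
  [rewrite min_l// leeD2l|rewrite min_r// leeD2l].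
Qed.

Lemma adde_minl a b c : mine b c + a = mine (b + a) (c + a).
Proof. by rewrite addeC adde_minr ![a + _]addeC. Qed.

Lemma addye_min a b : a != -oo -> mine (+oo + a) b = b.
Proof. by move=> a0; rewrite addye// min_r// leey. Qed.

Lemma mine_neqNy a b : a != -oo -> b != -oo -> mine a b != -oo.
Proof. by move=> a0 b0; case: leP. Qed.

Lemma adde_neqNy a b : a != -oo -> b != -oo -> a + b != -oo.
Proof. by move: a b => [a| |] [b| |]. Qed.

Section Vectors.
Variable I : Type.
Implicit Types x y z : I -> \bar R.

Definition proper_vector x := forall i, x i != -oo.

Definition in_span x y z := exists l m, [/\ l != -oo, m != -oo &
  forall i, z i = mine (l + x i) (m + y i)].

Definition span_dependent x y z :=
  [\/ in_span y z x, in_span x z y | in_span x y z].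

(** When everything is finite: z_i - x_i is the largest of the differences
    z_j - x_j, so that the least multiple of x above z touches z at i.  The
    subtraction-free form is what makes sense at +oo and passes to limits. *)
Definition attains x z i := forall j, z j + x i <= z i + x j.

(** The closed form of membership of z in the span of x and y: each coordinate
    of z is attained by the least multiple of x or of y lying above z. *)
Definition sector_cover x y z := forall i, attains x z i \/ attains y z i.

Definition sector_dependent x y z :=
  [\/ sector_cover y z x, sector_cover x z y | sector_cover x y z].

Lemma sector_coverC x y z : sector_cover x y z -> sector_cover y x z.
Proof. by move=> h i; case: (h i); [right|left]. Qed.

Lemma sector_dependent_rot x y z :
  sector_dependent x y z -> sector_dependent y z x.
Proof.
by case=> [?|/sector_coverC ?|/sector_coverC ?];
  [constructor 3|constructor 1|constructor 2].
Qed.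

Lemma in_spanC x y z : in_span x y z -> in_span y x z.
Proof. by move=> [l [m [l0 m0 E]]]; exists m, l; split => // i; rewrite minC. Qed.

(** The multiplier +oo removes the second vector from the combination. *)
Lemma in_span_left x y : proper_vector y -> in_span x y x.
Proof.
by move=> py; exists 0, +oo; split => // i; rewrite minC addye_min// add0e.
Qed.

Lemma in_span_right x y : proper_vector x -> in_span x y y.
Proof. by move=> px; exact/in_spanC/in_span_left. Qed.

Lemma in_span_infty x y z : proper_vector x -> proper_vector y ->
  (forall i, z i = +oo) -> in_span x y z.
Proof.
by move=> px py zy; exists +oo, +oo; split => // i; rewrite !addye// zy minxx.
Qed.

Lemma in_span_trans u v x y z : in_span u v x -> in_span u v y ->
  in_span x y z -> in_span u v z.
Proof.
move=> [lx [mx [lx0 mx0 ex]]] [ly [my [ly0 my0 ey]]] [l [m [l0 m0 ez]]].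
exists (mine (l + lx) (m + ly)), (mine (l + mx) (m + my)).
split; [by apply: mine_neqNy; apply: adde_neqNy..|move=> i].
by rewrite ez ex ey !adde_minr !adde_minl !addeA minACA.
Qed.

(** A vector with all coordinates +oo is a combination of any two others. *)
Lemma span_dependent_finite x y z :
  proper_vector x -> proper_vector y -> proper_vector z ->
  ((exists i, x i != +oo) -> (exists i, y i != +oo) -> (exists i, z i != +oo) ->
    span_dependent x y z) -> span_dependent x y z.
Proof.
move=> px py pz.
have fin (u : I -> \bar R) : (forall i, u i = +oo) \/ exists i, u i != +oo.
  have [H|/forallNP H] := pselect (exists i, u i != +oo); first by right.
  by left=> i; apply/eqP/negPn/negP.
have [xi|xf] := fin x; first by constructor 1; exact: in_span_infty.
have [yi|yf] := fin y; first by constructor 2; exact: in_span_infty.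
have [zi|zf] := fin z; first by constructor 3; exact: in_span_infty.
exact.
Qed.

End Vectors.

Ltac ereal_arith :=
  rewrite ?addeNy ?addNye ?addey ?addye ?leey ?leNye//= -?EFinD ?lee_fin ?leye_eq//=;
  try lra.

(** The witness is the pair of least multiples of x and y lying above z.  These
    exist as soon as x and y have a finite coordinate; otherwise the least
    multiplier would be -oo. *)
Lemma sector_cover_span (I : finType) (x y z : I -> \bar R) :
  proper_vector x -> proper_vector y -> proper_vector z ->
  (exists i, x i != +oo) -> (exists i, y i != +oo) ->
  sector_cover x y z -> in_span x y z.
Proof.
have scale (u : I -> \bar R) : proper_vector u -> proper_vector z ->
    (exists i, u i != +oo) -> exists l, [/\ l != -oo,
    forall i, z i <= l + u i & forall i, attains u z i -> l + u i <= z i].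
  (* For u_j = +oo the difference z_j - u_j is -oo, even if z_j = +oo: such a j
     imposes no constraint on the multiplier. *)
  move=> pu pz [i0 ui0]; pose l := \big[maxe/-oo]_j (z j - u j).
  have ln : l != -oo.
    rewrite -ltNye; apply: lt_le_trans (le_bigmax _ _ i0).
    move: (pu i0) (pz i0) ui0; case: (u i0) (z i0) => [r| |] [s| |]//= _ _ _.
    by rewrite -EFinD ltNyr.
  exists l; split => // i.
    have := le_bigmax -oo (fun j => z j - u j) i; rewrite -/l.
    move: (pu i) (pz i) ln.
    by case: (u i) (z i) (l) => [r| |] [s| |] [t| |]//= _ _ _; ereal_arith.
  move=> zi; have [->|ziy] := eqVneq (z i) +oo; first by rewrite leey.
  have ui : u i != +oo.
    apply: contra_neq ui0 => ui; move: (zi i0); rewrite ui.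
    by move: (pz i) (pz i0) (pu i0) ziy;
      case: (z i) (z i0) (u i0) => [r| |] [s| |] [t| |]//= _ _ _ _; ereal_arith.
  suff : l <= z i - u i.
    move: (pu i) (pz i) ln ui ziy.
    by case: (u i) (z i) (l) => [r| |] [s| |] [t| |]//= _ _ _ _ _; ereal_arith.
  apply/bigmax_leP; split=> [|j _]; first by rewrite leNye.
  move: (zi j) (pu i) (pz i) ui ziy (pu j) (pz j).
  by case: (u i) (z i) (u j) (z j) => [r| |] [s| |] [t| |] [v| |]//= + _ _ _ _ _ _;
    ereal_arith.
move=> px py pz xf yf cov.
have [l [l0 lz lx]] := scale x px pz xf; have [m [m0 mz my]] := scale y py pz yf.
exists l, m; split => // i; apply/eqP; rewrite eq_le le_min lz mz/= ge_min.
by case: (cov i) => [/lx ->//|/my ->]; rewrite orbT.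
Qed.

Lemma sector_dependent_span (I : finType) (x y z : I -> \bar R) :
  proper_vector x -> proper_vector y -> proper_vector z ->
  sector_dependent x y z -> span_dependent x y z.
Proof.
move=> px py pz D; apply: span_dependent_finite => // xf yf zf.
by case: D => D; [constructor 1|constructor 2|constructor 3];
  exact: sector_cover_span.
Qed.

(** By induction on the number of vectors.  A new vector is dependent with the
    current spanning pair: either it lies in the span, or it can replace one
    member of the pair, because that member is a combination of the new vector
    and the other member. *)
Lemma span_of_two (I : Type) N (X : nat -> I -> \bar R) :
  (forall k, (k <= N.+1)%N -> proper_vector (X k)) ->
  (forall i j k, (i < j < k)%N -> (k <= N.+1)%N -> span_dependent (X i) (X j) (X k)) ->
  exists u v, (u < v <= N.+1)%N /\
    forall k, (k <= N.+1)%N -> in_span (X u) (X v) (X k).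
Proof.
elim: N => [|N IH] pX D.
  exists 0%N, 1%N; split => // -[|[|//]] _.
    by apply: in_span_left; exact: pX.
  by apply: in_span_right; exact: pX.
have [||u [v [/andP[uv vN] S]]] := IH.
- by move=> k kN; apply: pX; lia.
- by move=> i j k ijk kN; apply: D => //; lia.
have pu : proper_vector (X u) by apply: pX; lia.
have pv : proper_vector (X v) by apply: pX; lia.
have pN : proper_vector (X N.+2) by apply: pX; lia.
have old k : (k <= N.+2)%N -> k = N.+2 \/ (k <= N.+1)%N by lia.
case: (D u v N.+2) => [| |D1|D1|D1]; first by lia.
- by lia.
- exists v, N.+2; split; first by lia.
  move=> k /old[->|/S Sk]; first exact: in_span_right.
  by apply: in_span_trans Sk => //; exact: in_span_left.
- exists u, N.+2; split; first by lia.
  move=> k /old[->|/S Sk]; first exact: in_span_right.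
  by apply: in_span_trans Sk => //; exact: in_span_left.
- exists u, v; split; first by lia.
  by move=> k /old[->//|/S].
Qed.

Lemma span_of_two_ord (I : Type) N (X : 'I_N -> I -> \bar R) : (1 < N)%N ->
  (forall k, proper_vector (X k)) ->
  (forall i j k : 'I_N, (i < j < k)%N -> span_dependent (X i) (X j) (X k)) ->
  exists u v, forall k, in_span (X u) (X v) (X k).
Proof.
case: N X => [//|[//|N]] X _ pX D.
have [||u [v [_ S]]] := @span_of_two _ N (fun k => X (inord k)).
- by move=> k _; exact: pX.
- by move=> i j k ijk kN; apply: D; rewrite !inordK//; lia.
exists (inord u), (inord v) => k.
by have := S k; rewrite inord_val; apply; rewrite -ltnS.
Qed.

(** With slope the difference of the coordinates [true] and [false], the two
    inequalities say that the slope of y lies between those of x and z. *)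
Lemma middle_in_span (x y z : bool -> \bar R) :
  proper_vector x -> proper_vector y -> proper_vector z ->
  (exists i, x i != +oo) -> (exists i, z i != +oo) ->
  x true + y false <= y true + x false ->
  y true + z false <= z true + y false ->
  in_span x z y.
Proof.
move=> px py pz xf zf xy yz.
have [[yt yfl]|yfin] := pselect (y true = +oo /\ y false = +oo).
  by apply: in_span_infty => // -[].
(* The multiple of x is tight at [true], the multiple of z at [false]. *)
pose l := if x true == +oo then +oo else y true - x true.
pose m := if z false == +oo then +oo else y false - z false.
have xf' : ~ (x true = +oo /\ x false = +oo) by case: xf => -[] /eqP; tauto.
have zf' : ~ (z true = +oo /\ z false = +oo) by case: zf => -[] /eqP; tauto.
suff [l0 m0 yt yf] : [/\ l != -oo, m != -oo,
    y true = mine (l + x true) (m + z true) &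
    y false = mine (l + x false) (m + z false)].
  by exists l, m; split => // -[].
rewrite /l /m {xf zf l m}.
move: (px true) (px false) (py true) (py false) (pz true) (pz false).
move: xf' zf' yfin xy yz.
case: (x true) => [x1| |]//; case: (x false) => [x2| |]//;
case: (y true) => [y1| |]//; case: (y false) => [y2| |]//;
case: (z true) => [z1| |]//; case: (z false) => [z2| |]//=;
rewrite ?addeNy ?addNye ?addey ?addye ?leey ?leNye//= -?EFinD ?lee_fin ?leye_eq//=;
move=> xf zf yf xy yz _ _ _ _ _ _;
rewrite ?addeNy ?addNye ?addey ?addye ?leey ?leNye//= -?EFinD ?lee_fin ?leye_eq//=.
all: try tauto.
all: split=> //.
all: try (rewrite min_r; [congr EFin; lra| by rewrite ?leey ?lee_fin//=; lra]).
all: try (rewrite min_l; [congr EFin; lra| by rewrite ?leey ?lee_fin//=; lra]).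
all: by rewrite ?minxx.
Qed.

(** Some vector has a slope between those of the two others.  Totality of the
    comparison is enough to find it: any orientation of a triangle contains a
    directed path through its three vertices. *)
Lemma span_dependent_pairs (x y z : bool -> \bar R) :
  proper_vector x -> proper_vector y -> proper_vector z ->
  span_dependent x y z.
Proof.
move=> px py pz; apply: span_dependent_finite => // xf yf zf.
have tot (u v : bool -> \bar R) : u true + v false <= v true + u false \/
    v true + u false <= u true + v false.
  by case/orP: (le_total (u true + v false) (v true + u false)); [left|right].
have [xy|yx] := tot x y; have [yz|zy] := tot y z; have [zx|xz] := tot z x;
  do ?[by constructor 1; apply: middle_in_span|
       by constructor 2; apply: middle_in_span|
       by constructor 3; apply: middle_in_span|
       by constructor 1; apply/in_spanC/middle_in_span|
       by constructor 2; apply/in_spanC/middle_in_span|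
       by constructor 3; apply/in_spanC/middle_in_span].
Qed.

(** The rows are combinations of u and v, so a relation between the pairs
    (u_j, v_j) for three indices j carries over to every row. *)
Lemma span_dependent_transpose (I J : Type) (A : I -> J -> \bar R) (u v : J -> \bar R)
    (j1 j2 j3 : J) :
  proper_vector u -> proper_vector v -> (forall i, in_span u v (A i)) ->
  span_dependent (A^~ j1) (A^~ j2) (A^~ j3).
Proof.
move=> pu pv A_uv.
pose col j (b : bool) := if b then u j else v j.
have pcol j : proper_vector (col j) by case; [exact: pu|exact: pv].
have lift (a b c : J) : in_span (col a) (col b) (col c) ->
    in_span (A^~ a) (A^~ b) (A^~ c).
  move=> [l [m [l0 m0 E]]]; exists l, m; split => // i.
  have [s [t [s0 t0 Ei]]] := A_uv i.
  rewrite !Ei (E true : u c = _) (E false : v c = _) /col !adde_minr.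
  by rewrite !addeA ![l + _]addeC ![m + _]addeC minACA.
by case: (span_dependent_pairs (pcol j1) (pcol j2) (pcol j3)) => /lift;
  [constructor 1|constructor 2|constructor 3].
Qed.

(** Dependence of rows in all 3 x 3 blocks becomes dependence of columns in
    all d x 3 blocks, and then a decomposition of the whole matrix. *)
Lemma two_term_decomposition d n (w : 'I_d -> 'I_n -> \bar R) :
  (1 < d)%N -> (2 < n)%N -> (forall i j, w i j != -oo) ->
  (forall (i1 i2 i3 : 'I_d) (j1 j2 j3 : 'I_n), (i1 < i2 < i3)%N -> (j1 < j2 < j3)%N ->
     let r i (k : 'I_3) := w i (tnth [tuple j1; j2; j3] k) in
     sector_dependent (r i1) (r i2) (r i3)) ->
  exists p q p' q', [/\ proper_vector p, proper_vector q,
    proper_vector p', proper_vector q' &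
    forall i j, w i j = mine (p i + q j) (p' i + q' j)].
Proof.
move=> d1 n2 pw D.
have colD (j1 j2 j3 : 'I_n) : (j1 < j2 < j3)%N ->
    span_dependent (w^~ j1) (w^~ j2) (w^~ j3).
  move=> j123.
  pose r i (k : 'I_3) := w i (tnth [tuple j1; j2; j3] k).
  have [|i1 i2 i3 i123|u [v S]] := @span_of_two_ord _ d r d1.
  - by move=> i k; exact: pw.
  - apply: sector_dependent_span; try by move=> k; exact: pw.
    exact: D.
  have pr i : proper_vector (r i) by move=> k; exact: pw.
  exact: (span_dependent_transpose (@Ordinal 3 0 isT) (@Ordinal 3 1 isT)
    (@Ordinal 3 2 isT) (pr u) (pr v) S).
have [|u [v S]] := @span_of_two_ord _ n (fun j i => w i j) (ltnW n2) _ colD.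
  by move=> j i; exact: pw.
have [f Hf] := choice S; have [g Hg] := choice Hf.
exists (w^~ u), f, (w^~ v), g; split.
- by move=> i; exact: pw.
- by move=> j; case: (Hg j).
- by move=> i; exact: pw.
- by move=> j; case: (Hg j).
- by move=> i j; case: (Hg j) => _ _ ->; rewrite [f j + _]addeC [g j + _]addeC.
Qed.

End TropicalDependence.

(** * Singular positive matrices of size three *)

Section PositiveSingular.
Variable R : realType.
Local Notation PC := (puiseux R[i]).

Definition k0 : 'I_3 := @Ordinal 3 0 isT.
Definition k1 : 'I_3 := @Ordinal 3 1 isT.
Definition k2 : 'I_3 := @Ordinal 3 2 isT.

Lemma ord3P (i : 'I_3) : [\/ i = k0, i = k1 | i = k2].
Proof.
by case: i => -[|[|[|//]]] p; [constructor 1|constructor 2|constructor 3];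
  exact: val_inj.
Qed.

(** The even and the odd terms are kept apart, as the argument compares their
    two sums. *)
Lemma det_mx33E (K : comNzRingType) (A : 'M[K]_3) :
  \det A =
    (A k0 k0 * (A k1 k1 * A k2 k2) +
      (A k0 k1 * (A k1 k2 * A k2 k0) + A k0 k2 * (A k1 k0 * A k2 k1)))
    - (A k0 k0 * (A k1 k2 * A k2 k1) +
      (A k0 k1 * (A k1 k0 * A k2 k2) + A k0 k2 * (A k1 k1 * A k2 k0))).
Proof.
pose a (i j : nat) : K := A (inord i) (inord j).
have E i j : A i j = a i j by rewrite /a !inord_val.
rewrite (expand_det_row _ ord0) !big_ord_recl big_ord0.
rewrite /cofactor !(expand_det_row _ ord0) !big_ord_recl !big_ord0.
rewrite /cofactor !det_mx11 !mxE; clearbody a; rewrite !E /= /bump /=.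
ring.
Qed.

(** The identity and the transposition of c1 and c2 both attain the tropical
    determinant.  The tie makes x and y proportional on c1, c2.  If x is the
    smaller of the two, relative to this proportion, at c3, then x is the sum of
    multiples of y, tight at c1 and c2, and of z, tight at c3; otherwise x and y
    exchange roles. *)
Lemma sector_dependent_tie (I : Type) (x y z : I -> rat) (c1 c2 c3 : I) :
  (forall c, [\/ c = c1, c = c2 | c = c3]) ->
  x c1 + (y c2 + z c3) = x c2 + (y c1 + z c3) ->
  x c1 + (y c2 + z c3) <= x c1 + (y c3 + z c2) ->
  x c1 + (y c2 + z c3) <= x c2 + (y c3 + z c1) ->
  x c1 + (y c2 + z c3) <= x c3 + (y c1 + z c2) ->
  x c1 + (y c2 + z c3) <= x c3 + (y c2 + z c1) ->
  let e (u : I -> rat) i := (ratr (u i) : R)%:E in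
  sector_dependent (e x) (e y) (e z).
Proof.
move=> c123 tie h1 h2 h3 h4 e.
have attE (u v : I -> rat) i : attains (e u) (e v) i <->
    forall j, v j + u i <= v i + u j.
  by split=> h j; have := h j; rewrite /e -!EFinD lee_fin -!rmorphD ler_rat.
have [xy|yx] := leP (x c3 + y c1) (y c3 + x c1).
  constructor 1 => i; case: (c123 i) => ->; [left|left|right];
  by apply/attE => j; case: (c123 j) => ->; lra.
constructor 2 => i; case: (c123 i) => ->; [left|left|right];
by apply/attE => j; case: (c123 j) => ->; lra.
Qed.

(** No cancellation can occur among the even terms of the determinant, nor
    among the odd ones, so both minima coincide. *)
Lemma positive_singular (X : 'M[PC]_3) (q : 'I_3 -> 'I_3 -> rat) :
  (forall i j, pos_of_val (X i j) (q i j)) -> \det X = 0 ->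
  let r i j := (ratr (q i j) : R)%:E in
  sector_dependent (r k0) (r k1) (r k2).
Proof.
move=> Xq; rewrite det_mx33E => /eqP; rewrite subr_eq0 => /eqP EO r.
have term i j k :=
  pos_of_valM (Xq k0 i) (pos_of_valM (Xq k1 j) (Xq k2 k)).
have := pos_of_valD (term k0 k1 k2) (pos_of_valD (term k1 k2 k0) (term k2 k0 k1)).
have := pos_of_valD (term k0 k2 k1) (pos_of_valD (term k1 k0 k2) (term k2 k1 k0)).
rewrite -EO => /pos_of_val_inj H /H {H term EO Xq}.
have min3 (a b c : rat) : let m := Num.min a (Num.min b c) in
    [/\ m <= a, m <= b, m <= c & [\/ m = a, m = b | m = c]].
  split; rewrite ?ge_min ?lexx ?orbT//.
  by case: (leP b c) => _; case: leP => _;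
    [constructor 1|constructor 2|constructor 1|constructor 3].
set m := Num.min (q k0 k0 + _) _; set e := (X in _ = X) => oe.
have [b1 b2 b3 bP] := min3 (q k0 k0 + (q k1 k2 + q k2 k1))
  (q k0 k1 + (q k1 k0 + q k2 k2)) (q k0 k2 + (q k1 k1 + q k2 k0)).
case: (min3 (q k0 k0 + (q k1 k1 + q k2 k2))
  (q k0 k1 + (q k1 k2 + q k2 k0)) (q k0 k2 + (q k1 k0 + q k2 k1))).
rewrite -/e -oe -/m.
rewrite -/m in b1 b2 b3 bP; move=> e1 e2 e3 eP; clearbody m; clear e oe min3.
have cols (c1 c2 c3 : 'I_3) : c1 != c2 -> c1 != c3 -> c2 != c3 ->
    forall c, [\/ c = c1, c = c2 | c = c3].
  move=> n12 n13 n23 c; case: (eqVneq c c1); first by constructor 1.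
  case: (eqVneq c c2); first by constructor 2.
  by move=> m2 m1; constructor 3; apply: val_inj;
    move: (ltn_ord c) (ltn_ord c1) (ltn_ord c2) (ltn_ord c3) n12 n13 n23 m1 m2;
    rewrite -!val_eqE/=; lia.
have tie x y z c1 c2 c3 n12 n13 n23 :=
  @sector_dependent_tie _ (q x) (q y) (q z) c1 c2 c3 (cols c1 c2 c3 n12 n13 n23).
(* An even and an odd permutation agree at exactly one row; rotating the rows
   brings it to the last place. *)
by case: eP => eE; case: bP => bE;
  first [apply: (tie k0 k1 k2 k0 k1 k2) => //; lra
        |apply: (tie k0 k1 k2 k1 k2 k0) => //; lra
        |apply: (tie k0 k1 k2 k2 k0 k1) => //; lra
        |apply: sector_dependent_rot; apply: (tie k2 k0 k1 k0 k1 k2) => //; lra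
        |apply: sector_dependent_rot; apply: (tie k2 k0 k1 k1 k2 k0) => //; lra
        |apply: sector_dependent_rot; apply: (tie k2 k0 k1 k2 k0 k1) => //; lra
        |do 2 apply: sector_dependent_rot; apply: (tie k1 k2 k0 k0 k1 k2) => //; lra
        |do 2 apply: sector_dependent_rot; apply: (tie k1 k2 k0 k1 k2 k0) => //; lra
        |do 2 apply: sector_dependent_rot; apply: (tie k1 k2 k0 k2 k0 k1) => //; lra].
Qed.

End PositiveSingular.

(** * Limits of valuations *)

Section Closure.
Local Open Scope ereal_scope.
Variable R : realType.

Lemma cvge_lt_near (T : Type) (F : set_system T) {FF : Filter F}
    (f g : T -> \bar R) a b :
  f x @[x --> F] --> a -> g x @[x --> F] --> b -> a < b ->
  \forall x \near F, f x < g x.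
Proof.
move=> fa gb ab.
have [c /andP[ac cb]] : exists c, a < c < b.
  case: a b ab {fa gb} => [r| |] [s| |]//=; rewrite ?lte_fin => rs.
  - by exists ((r + s) / 2)%:E; rewrite !lte_fin; lra.
  - by exists (r + 1)%:E; rewrite lte_fin ltry; lra.
  - by exists (s - 1)%:E; rewrite lte_fin ltNyr; lra.
  - by exists 0; rewrite ltNyr ltry.
have fc : \forall x \near F, f x < c.
  have lim : nbhs a [set x | x < c].
    apply: open_nbhs_nbhs; split => //.
    by have := lray_open c; rewrite set_itvE.
  exact: fa _ lim.
have gc : \forall x \near F, c < g x.
  have lim : nbhs b [set x | c < x].
    apply: open_nbhs_nbhs; split => //.
    by have := rray_open c; rewrite set_itvE.
  exact: gb _ lim.
by apply: filterS2 fc gc => x; exact: lt_trans.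
Qed.

(** Addition of extended reals is continuous away from -oo, so the strict
    inequality that refutes [attains] persists nearby. *)
Lemma not_attains_near (T : Type) (F : set_system T) {FF : Filter F} (I : Type)
    (x z : T -> I -> \bar R) (x0 z0 : I -> \bar R) i :
  proper_vector x0 -> proper_vector z0 ->
  (forall i, x t i @[t --> F] --> x0 i) -> (forall i, z t i @[t --> F] --> z0 i) ->
  ~ attains x0 z0 i -> \forall t \near F, ~ attains (x t) (z t) i.
Proof.
move=> px pz cx cz /existsNP[j /negP]; rewrite -ltNge => lt_ij.
have def (u v : I -> \bar R) k l : proper_vector u -> proper_vector v -> u k +? v l.
  move=> pu pv; move: (pu k) (pv l).
  by case: (u k) (v l) => [?| |] [?| |].
have c1 := cvgeD (def _ _ i j pz px) (cz i) (cx j).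
have c2 := cvgeD (def _ _ j i pz px) (cz j) (cx i).
have := cvge_lt_near (FF := FF) (c1 FF) (c2 FF) lt_ij; apply: filterS => t lt_t /(_ j).
by rewrite leNgt lt_t.
Qed.

Lemma rat_approx (x : \bar R) : x != -oo ->
  exists u : nat -> rat, (ratr (u k) : R)%:E @[k --> \oo] --> x.
Proof.
case: x => [r| |] // _.
  have ex k : exists q : rat, (r < ratr q < r + k.+1%:R^-1)%R.
    have /rat_in_itvoo[q] : (r < r + k.+1%:R^-1)%R by rewrite ltrDl invr_gt0.
    by rewrite in_itv/= => ?; exists q.
  have [u Hu] := choice ex; exists u.
  apply: cvg_EFin; first by near=> k.
  apply: (@squeeze_cvgr _ _ _ _ (fun=> r) (fun k => r + k.+1%:R^-1)%R).
  - near=> k; have /andP[/ltW -> /ltW ->] := Hu k; exact: isT.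
  - exact: cvg_cst.
  - rewrite -[X in _ --> X]addr0; apply: cvgD; first exact: cvg_cst.
    exact: cvg_harmonic.
exists (fun k => k%:R); apply/cvgeryP.
under eq_fun do rewrite ratr_nat.
exact: cvgr_idn.
Unshelve. all: by end_near.
Qed.

Lemma cvge_min (T : Type) (F : set_system T) {FF : Filter F}
    (f g : T -> \bar R) a b :
  f x @[x --> F] --> a -> g x @[x --> F] --> b ->
  mine (f x) (g x) @[x --> F] --> mine a b.
Proof.
move=> fa gb.
apply: (@continuous2_cvg _ (\bar R) (\bar R) (\bar R) F _ f g
  (fun x y => mine x y) a b) => //.
exact: (@min_continuous _ (\bar R) (a, b)).
Qed.

Lemma closure_entrywise d n (S : set 'M[\bar R]_(d, n))
    (v : nat -> 'M[\bar R]_(d, n)) (w : 'M[\bar R]_(d, n)) :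
  (forall k, S (v k)) -> (forall i j, v k i j @[k --> \oo] --> w i j) -> closure S w.
Proof.
move=> Sv vw B [P wP PB].
have : \forall k \near \oo, forall ij : 'I_d * 'I_n, P ij.1 ij.2 (v k ij.1 ij.2).
  by apply: filter_forall => -[i j]; apply: vw; exact: wP.
move=> [N _ /(_ N (leqnn N)) H].
by exists (v N); split => //; apply: PB => i j; exact: (H (i, j)).
Qed.

Lemma entry_continuous d n (w : 'M[\bar R]_(d, n)) i j :
  v i j @[v --> w] --> w i j.
Proof.
move=> B wB; exists (fun i' j' => if (i' == i) && (j' == j) then B else setT).
  move=> i' j'; case: ifP => [/andP[/eqP -> /eqP ->]//|_]; exact: filterT.
by move=> v /(_ i j) /=; rewrite !eqxx.
Qed.

Lemma not_sector_cover_near (T : Type) (F : set_system T) {FF : Filter F} (I : Type)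
    (x y z : T -> I -> \bar R) (x0 y0 z0 : I -> \bar R) :
  proper_vector x0 -> proper_vector y0 -> proper_vector z0 ->
  (forall i, x t i @[t --> F] --> x0 i) -> (forall i, y t i @[t --> F] --> y0 i) ->
  (forall i, z t i @[t --> F] --> z0 i) ->
  ~ sector_cover x0 y0 z0 -> \forall t \near F, ~ sector_cover (x t) (y t) (z t).
Proof.
move=> px py pz cx cy cz /existsNP[i /not_orP[nx ny]].
have := not_attains_near (FF := FF) py pz cy cz ny.
have := not_attains_near (FF := FF) px pz cx cz nx.
by apply: filterS2 => t ntx nty /(_ i) [].
Qed.

Lemma not_sector_dependent_near (T : Type) (F : set_system T) {FF : Filter F} (I : Type)
    (x y z : T -> I -> \bar R) (x0 y0 z0 : I -> \bar R) :
  proper_vector x0 -> proper_vector y0 -> proper_vector z0 ->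
  (forall i, x t i @[t --> F] --> x0 i) -> (forall i, y t i @[t --> F] --> y0 i) ->
  (forall i, z t i @[t --> F] --> z0 i) ->
  ~ sector_dependent x0 y0 z0 ->
  \forall t \near F, ~ sector_dependent (x t) (y t) (z t).
Proof.
move=> px py pz cx cy cz nD.
have n1 : ~ sector_cover y0 z0 x0 by move=> ?; apply: nD; constructor 1.
have n2 : ~ sector_cover x0 z0 y0 by move=> ?; apply: nD; constructor 2.
have n3 : ~ sector_cover x0 y0 z0 by move=> ?; apply: nD; constructor 3.
have := not_sector_cover_near (FF := FF) px py pz cx cy cz n3.
have := not_sector_cover_near (FF := FF) px pz py cx cz cy n2.
have := not_sector_cover_near (FF := FF) py pz px cy cz cx n1.
by apply: filterS3 => t m1 m2 m3 [].
Qed.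

End Closure.

(** * The variety of matrices of rank at most two *)

Section RankTwoVariety.
Variables (R : realType) (d n : nat).
Local Notation PC := (puiseux R[i]).
Local Notation mxpoly := (mpoly (d * n) PC).

Lemma eval_minor (X : 'M[PC]_(d, n)) k (f : 'I_k -> 'I_d) (g : 'I_k -> 'I_n) :
  eval_mxpoly X (\det (mxsub f g (generic_mx R d n))) = \det (mxsub f g X).
Proof.
rewrite /eval_mxpoly -det_map_mx; congr (\det _); apply/matrixP => i j.
by rewrite !mxE -/(eval_mxpoly X _); have := eval_generic_mx X (f i) (g j); rewrite mxE.
Qed.

Lemma finite_minors k : finite_set (@minors R d n k).
Proof.
pose F (fg : {ffun 'I_k -> 'I_d} * {ffun 'I_k -> 'I_n}) : mxpoly :=
  \det (mxsub fg.1 fg.2 (generic_mx R d n)).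
apply: (@sub_finite_set _ _ (F @` setT)); last exact: finite_image.
move=> p [f [g [_ _ ->]]].
have -> : mxsub f g (generic_mx R d n) =
    mxsub (finfun f) (finfun g) (generic_mx R d n).
  by apply/matrixP => i j; rewrite mxE [RHS]mxE !ffunE.
by exists (finfun f, finfun g).
Qed.

Lemma det_rank_two (A : 'M[PC]_(d, 2)) (B : 'M[PC]_(2, n))
  (f : 'I_3 -> 'I_d) (g : 'I_3 -> 'I_n) : \det (mxsub f g (A *m B)) = 0.
Proof.
have -> : mxsub f g (A *m B) = rowsub f A *m colsub g B.
  by apply/matrixP => i j; rewrite !mxE; apply: eq_bigr => k _; rewrite !mxE.
apply/eqP/negPn/negP; rewrite -unitfE -unitmxE -row_free_unit => /eqP rk.
have := mxrankM_maxl (rowsub f A) (colsub g B).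
by rewrite rk => /leq_trans /(_ (rank_leq_col _)).
Qed.

Lemma rank_two_zero_set (A : 'M[PC]_(d, 2)) (B : 'M[PC]_(2, n)) :
  zero_set (@determinantal_ideal R d n 2) (A *m B).
Proof.
move=> p [s sF ->]; rewrite /eval_mxpoly raddf_sum big_seq big1// => c cs.
have [f [g [_ _ ->]]] := sF c cs.
by rewrite /= mevalM -/(eval_mxpoly _ (\det _)) eval_minor det_rank_two mulr0.
Qed.

Lemma trop_sub (S T : set 'M[PC]_(d, n)) : S `<=` T -> trop S `<=` trop T.
Proof.
move=> ST w [cw pw]; split => //; apply: closureS cw.
by apply: image_subset => A [/ST].
Qed.

Lemma minors_sub_ideal r : @minors R d n r.+1 `<=` @determinantal_ideal R d n r.
Proof.
move=> p pm; exists [:: (1, p)]; first by move=> c; rewrite inE => /eqP ->.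
by rewrite big_seq1 mul1r.
Qed.

(** Otherwise dependence would fail near w, and in particular at the valuation of
    some positive matrix on the hypersurface. *)
Lemma trop_minor_dependent (f : 'I_3 -> 'I_d) (g : 'I_3 -> 'I_n) w :
  trop (zero_set [set \det (mxsub f g (generic_mx R d n))] `&`
    @positive_orthant R d n) w ->
  let r i k := w (f i) (g k) in sector_dependent (r k0) (r k1) (r k2).
Proof.
move=> [cw pw] r; apply: contrapT => nD.
have pr i : proper_vector (r i) by move=> k; exact: pw.
have cr i k : (v : 'M[\bar R]_(d, n)) (f i) (g k) @[v --> w] --> r i k.
  exact: entry_continuous.
have := not_sector_dependent_near (FF := nbhs_filter w)
  (pr k0) (pr k1) (pr k2) (cr k0) (cr k1) (cr k2) nD.
move=> /cw [_ [[X [[X0 Xpos] _] <-]]]; apply.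
have [q Hq] := choice (fun ij => (positive_puiseuxP (X ij.1 ij.2)).1 (Xpos ij.1 ij.2)).
have Xq i j : pos_of_val (mxsub f g X i j) (q (f i, g j)).
  by rewrite mxE; exact: (Hq (_, _)).
have := positive_singular Xq; rewrite -eval_minor => /(_ (X0 _ erefl)).
have E i : (fun k => (ratr (q (f i, g k)) : R)%:E) =
    (fun k => map_mx (@pval R) X (f i) (g k) : \bar R).
  by apply/funext => k; rewrite mxE (pval_pos (Hq (_, _))).
by rewrite /= !E.
Qed.

(** The lift is a product of a d x 2 and a 2 x n matrix of monomials with
    rational exponents converging to the given vectors. *)
Lemma two_term_in_trop (p p' : 'I_d -> \bar R) (q q' : 'I_n -> \bar R)
    (w : 'M[\bar R]_(d, n)) :
  proper_vector p -> proper_vector q -> proper_vector p' -> proper_vector q' ->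
  (forall i j, w i j = mine (p i + q j)%E (p' i + q' j)%E) ->
  trop (zero_set (@determinantal_ideal R d n 2) `&` @positive_orthant R d n) w.
Proof.
move=> pp pq pp' pq' wE.
have approx (I : Type) (x : I -> \bar R) : proper_vector x ->
    exists u : I -> nat -> rat, forall i, (ratr (u i k) : R)%:E @[k --> \oo] --> x i.
  by move=> px; have [u Hu] := choice (fun i => rat_approx (px i)); exists u.
have [a Ha] := approx _ _ pp; have [b Hb] := approx _ _ pq.
have [a' Ha'] := approx _ _ pp'; have [b' Hb'] := approx _ _ pq'.
pose A k : 'M[PC]_(d, 2) :=
  \matrix_(i, s) if s == 0 then monomial R (a i k) else monomial R (a' i k).
pose B k : 'M[PC]_(2, n) :=
  \matrix_(s, j) if s == 0 then monomial R (b j k) else monomial R (b' j k).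
have val k i j : pos_of_val ((A k *m B k) i j)
    (Num.min (a i k + b j k) (a' i k + b' j k)).
  rewrite mxE big_ord_recl big_ord1 !mxE /=.
  by apply: pos_of_valD; apply: pos_of_valM; exact: pos_of_val_monomial.
split; last first.
  by move=> i j; rewrite wE mine_neqNy// adde_neqNy// ?pp ?pq ?pp' ?pq'.
apply: (@closure_entrywise _ _ _ _ (fun k => map_mx (@pval R) (A k *m B k))).
  move=> k; exists (A k *m B k) => //; split; last first.
    by move=> i j; exact: pos_of_val_nz (val k i j).
  split; first exact: rank_two_zero_set.
  by move=> i j; apply/positive_puiseuxP; eexists; exact: val.
move=> i j.
have sum_def (x y : \bar R) : x != -oo%E -> y != -oo%E -> (x +? y)%E.
  by case: x y => [?| |] [?| |].
have := cvge_min (FF := eventually_filter)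
  (cvgeD (sum_def _ _ (pp i) (pq j)) (Ha i) (Hb j))
  (cvgeD (sum_def _ _ (pp' i) (pq' j)) (Ha' i) (Hb' j)).
rewrite -wE => lim.
have -> : (fun k => map_mx (@pval R) (A k *m B k) i j) = fun k =>
    mine ((ratr (a i k))%:E + (ratr (b j k))%:E)%E
         ((ratr (a' i k))%:E + (ratr (b' j k))%:E)%E.
  apply/funext => k.
  rewrite mxE (pval_pos (val k i j)) -!EFinD -!rmorphD -EFin_min.
  by rewrite minr_rat.
exact: lim.
Qed.

End RankTwoVariety.

Theorem theorem5p3 (R : realType) (d n : nat) (hd : (3 <= d)%N) (hn : (3 <= n)%N) :
  @positive_tropical_generators R d n (@minors R d n 3)
    (@determinantal_ideal R d n 2).
Proof.
split; first exact: finite_minors.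
apply/seteqP; split=> [w tw p pm|w tw].
  apply: trop_sub tw => X [X0 Xpos]; split => // _ ->.
  by apply: X0; exact: minors_sub_ideal.
have increasing m (x1 x2 x3 : 'I_m) : (x1 < x2 < x3)%N ->
    {homo (fun k : 'I_3 => tnth [tuple x1; x2; x3] k) : i j / (i < j)%N}.
  move=> x123 i j.
  by case: (ord3P i) => ->; case: (ord3P j) => -> //=; rewrite !(tnth_nth x1)/=; lia.
have pw i j : w i j != -oo%E.
  (* One minor is enough, and d, n >= 3 provides it. *)
  have m0 : minors 3 (\det (mxsub (widen_ord hd) (widen_ord hn) (generic_mx R d n))).
    by exists (widen_ord hd), (widen_ord hn); split.
  exact: (tw _ m0).2.
have [i1 i2 i3 j1 j2 j3 i123 j123|p [q [p' [q' [pp pq pp' pq' wE]]]]] :=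
  two_term_decomposition (ltnW hd) hn pw.
  apply: (@trop_minor_dependent R d n (tnth [tuple i1; i2; i3])
    (tnth [tuple j1; j2; j3])).
  apply: tw; exists (tnth [tuple i1; i2; i3]), (tnth [tuple j1; j2; j3]).
  by split => //; exact: increasing.
exact: two_term_in_trop wE.
Qed.
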